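(* Let $n\ge2$ and let $G$ be a proper convex subdomain of $\mathbb{R}^n$. Let $x,y\in G$ and $t=e^{j_G(x,y)}-1$. Then $$\arcsin\frac{t}{t+2}\le v_G(x,y)\le 2\arcsin\frac{t}{\sqrt{4+t^2}}.$$ The left-hand inequality is sharp (there are a proper convex domain $G$ and distinct points $x,y\in G$ for which equality holds), and the constant $2$ (the factor multiplying $\arcsin$) in the right-hand side is the best possible (it cannot be replaced by any smaller constant in the inequality for all proper convex domains $G$ and all $x,y\in G$).
   Context: For a domain $G\subsetneq\mathbb{R}^n$ whose boundary $\partial G$ is not a proper subset of a line, the visual angle metric is $v_G(x,y)=\sup_{z\in\partial G}\measuredangle(x,z,y)$ for $x,y\in G$, where $\measuredangle(x,z,y)\in[0,\pi]$ is the angle at $z$ between the segments $[x,z]$ and $[y,z]$ (so $v_G(x,x)=0$). The distance ratio metric of a proper open subset $G\subset\mathbb{R}^n$ is $$j_G(x,y)=\log\left(1+\frac{|x-y|}{\min\{d(x,\partial G),d(y,\partial G)\}}\right),\quad x,y\in G,$$ where $d(x,\partial G)$ is the Euclidean distance from $x$ to $\partial G$. *)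

(* Defs.v *)
From HB Require Import structures.
From mathcomp Require Import all_boot all_order all_algebra.
From mathcomp Require Import all_classical all_reals all_analysis.

Set Implicit Arguments.
Unset Strict Implicit.
Unset Printing Implicit Defensive.

Import Order.TTheory GRing.Theory Num.Theory.
Import numFieldNormedType.Exports.

Local Open Scope classical_set_scope.
Local Open Scope ring_scope.

(* R^n is 'rV[R]_n.  The library norm `|x| on matrices is the sup norm, so the
   Euclidean one is defined here; both induce the same topology, hence open,
   closure, interior and connected below are the library notions. *)

Definition dotp (R : realType) (n : nat) (u v : 'rV[R]_n) : R :=
  \sum_(i < n) u 0 i * v 0 i.

Definition enorm (R : realType) (n : nat) (u : 'rV[R]_n) : R :=
  Num.sqrt (dotp u u).

Definition boundary (T : topologicalType) (G : set T) : set T :=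
  closure G `\` interior G.

Definition domain (T : topologicalType) (G : set T) : Prop :=
  [/\ G !=set0, open G & connected G].

Definition proper_convex_domain (R : realType) (n : nat) (G : set 'rV[R]_n) :=
  [/\ domain G, convex_set G & G != setT].

Definition dist_boundary (R : realType) (n : nat) (G : set 'rV[R]_n)
    (x : 'rV[R]_n) : R :=
  inf [set enorm (x - z) | z in boundary G].

(* angle x z y is the angle at the middle point z; it is meaningful only for
   z != x and z != y (acos is applied to 0 otherwise). *)
Definition angle (R : realType) (n : nat) (x z y : 'rV[R]_n) : R :=
  acos (dotp (x - z) (y - z) / (enorm (x - z) * enorm (y - z))).

(* The set of angles lies in [0, pi] for x, y in an open set G, and is nonempty
   when G has boundary points, so the real-valued sup is the true supremum. *)
Definition visual_angle (R : realType) (n : nat) (G : set 'rV[R]_n)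
    (x y : 'rV[R]_n) : R :=
  sup [set angle x z y | z in boundary G].

Definition dist_ratio (R : realType) (n : nat) (G : set 'rV[R]_n)
    (x y : 'rV[R]_n) : R :=
  ln (1 + enorm (x - y) / Num.min (dist_boundary G x) (dist_boundary G y)).

(* Main.v *)
Require Import Defs.
From HB Require Import structures.
From mathcomp Require Import all_boot all_order all_algebra.
From mathcomp Require Import all_classical all_reals all_analysis.
From mathcomp Require Import ring lra.

Set Implicit Arguments.
Unset Strict Implicit.
Unset Printing Implicit Defensive.

Import Order.TTheory GRing.Theory Num.Theory.
Import numFieldNormedType.Exports.

Local Open Scope classical_set_scope.
Local Open Scope ring_scope.

(** Write [m] for the smaller of the distances of [x] and [y] to the boundary of
[G], so that [t = |x - y| / m].

Upper bound.  In a convex set the distance to the boundary is at least [m] along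
the whole segment [[x, y]] ([boundary_away_from_segment]).  From a boundary
point [z], the bisector of the angle at [z] meets the segment at distance at
least [m], and this forces the half-angle to be at most [arctan (t / 2)], which
is the arcsine in the statement ([angle_le_away_from_segment]).

Lower bound.  Let [z] be a boundary point at distance [r] from [x]; later [r]
tends to [m].  A ball with [x] and [y] on its sphere and radius
[r + |x - y| / 2] consists of points seeing the segment under an angle of
at least [asin (|x - y| / (|x - y| + 2 r))] ([angle_ge_in_ball]).  Take two such balls, symmetric about the midpoint of [x]
and [y].  The point [z] is the midpoint of a point of the first ball and a point
of the second; [z] is not in [G], so by convexity one of the two points is not
in [G] either.  Hence one of the balls contains both [x] and a point outside
[G], and therefore a boundary point of [G]
([visual_angle_ge_boundary_point]).

Sharpness.  Both extremal configurations live in a half-space: two points on a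
common normal give equality on the left ([halfspace_lower_sharp]), and two
points at height [1] and distance [2] give equality on the right with [t = 2]
([halfspace_right_angle]), where any factor smaller than [2] fails. *)

(** * Euclidean inner product and norm *)

Section Euclidean.
Context {R : realType} {n : nat}.
Implicit Types (u v w e p g : 'rV[R]_n) (c s : R).

Lemma dotpC u v : dotp u v = dotp v u.
Proof. by apply: eq_bigr => i _; rewrite mulrC. Qed.

Lemma dotpDl u v w : dotp (u + v) w = dotp u w + dotp v w.
Proof. by rewrite -big_split; apply: eq_bigr => i _; rewrite mxE mulrDl. Qed.

Lemma dotpZl c u v : dotp (c *: u) v = c * dotp u v.
Proof. by rewrite mulr_sumr; apply: eq_bigr => i _; rewrite mxE mulrA. Qed.

Lemma dotpNl u v : dotp (- u) v = - dotp u v.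
Proof. by rewrite -scaleN1r dotpZl mulN1r. Qed.

Lemma dotpDr u v w : dotp u (v + w) = dotp u v + dotp u w.
Proof. by rewrite dotpC dotpDl !(dotpC u). Qed.

Lemma dotpZr c u v : dotp u (c *: v) = c * dotp u v.
Proof. by rewrite dotpC dotpZl dotpC. Qed.

Lemma dotpNr u v : dotp u (- v) = - dotp u v.
Proof. by rewrite dotpC dotpNl dotpC. Qed.

Definition dotpE := (dotpDl, dotpDr, dotpZl, dotpZr, dotpNl, dotpNr).

Lemma dotp0l u : dotp 0 u = 0.
Proof. by rewrite -(scale0r 0) dotpZl mul0r. Qed.

Lemma dotp_ge0 u : 0 <= dotp u u.
Proof. by apply: sumr_ge0 => i _; rewrite -expr2 sqr_ge0. Qed.

Lemma sqr_coord_le_dotp u i : u 0 i ^+ 2 <= dotp u u.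
Proof.
rewrite /dotp (bigD1 i) //= -expr2 lerDl.
by apply: sumr_ge0 => j _; rewrite -expr2 sqr_ge0.
Qed.

Lemma dotp_gt0 u : u != 0 -> 0 < dotp u u.
Proof.
apply: contraNT; rewrite -leNgt => u0; apply/eqP/rowP => i; rewrite mxE.
have := le_trans (sqr_coord_le_dotp u i) u0.
by rewrite le_eqVlt ltNge sqr_ge0 orbF sqrf_eq0 => /eqP.
Qed.

Lemma enorm_ge0 u : 0 <= enorm u.
Proof. exact: sqrtr_ge0. Qed.

Lemma enorm_sqr u : enorm u ^+ 2 = dotp u u.
Proof. by rewrite sqr_sqrtr ?dotp_ge0. Qed.

Lemma enorm_gt0 u : u != 0 -> 0 < enorm u.
Proof. by move=> u0; rewrite sqrtr_gt0 dotp_gt0. Qed.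

Lemma enorm0 : enorm (0 : 'rV[R]_n) = 0.
Proof. by rewrite /enorm dotp0l sqrtr0. Qed.

Lemma enormN u : enorm (- u) = enorm u.
Proof. by rewrite /enorm !dotpE opprK. Qed.

Lemma enormB u v : enorm (u - v) = enorm (v - u).
Proof. by rewrite -enormN opprB. Qed.

Lemma enormZ c u : enorm (c *: u) = `|c| * enorm u.
Proof.
by rewrite /enorm !dotpE mulrA -expr2 sqrtrM ?sqr_ge0 // sqrtr_sqr.
Qed.

Lemma enorm_le u c : 0 <= c -> dotp u u <= c ^+ 2 -> enorm u <= c.
Proof.
by move=> c0 uc; rewrite -(ler_pXn2r (isT : (0 < 2)%N)) ?nnegrE ?enorm_ge0 //
  enorm_sqr.
Qed.

Lemma normr_coord_le_enorm u i : `|u 0 i| <= enorm u.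
Proof. by rewrite -sqrtr_sqr ler_wsqrtr // sqr_coord_le_dotp. Qed.

Lemma cauchy_schwarz u v : `|dotp u v| <= enorm u * enorm v.
Proof.
have [->|u0] := eqVneq u 0; first by rewrite dotp0l enorm0 normr0 mul0r.
have uu := dotp_gt0 u0.
rewrite -(ler_pXn2r (isT : (0 < 2)%N)) ?nnegrE ?mulr_ge0 ?enorm_ge0 //.
rewrite exprMn !enorm_sqr real_normK ?num_real //.
have := dotp_ge0 (dotp u u *: v - dotp u v *: u).
rewrite !dotpE (dotpC v u).
set a := dotp u u in uu *; set b := dotp u v; set d := dotp v v => H.
have {H} : 0 <= a * (a * d - b ^+ 2) by lra.
by rewrite pmulr_rge0 // subr_ge0.
Qed.

Lemma dotp_le_enorm u v : dotp u v <= enorm u * enorm v.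
Proof. exact: le_trans (ler_norm _) (cauchy_schwarz u v). Qed.

Lemma ler_enormD u v : enorm (u + v) <= enorm u + enorm v.
Proof.
apply: enorm_le; first by rewrite addr_ge0 ?enorm_ge0.
have := dotp_le_enorm u v.
rewrite sqrrD !enorm_sqr !dotpE (dotpC v u); lra.
Qed.

Lemma dotp_segment_le s u v : 0 <= s <= 1 ->
  dotp (u + s *: (v - u)) (u + s *: (v - u)) <=
  (1 - s) * dotp u u + s * dotp v v.
Proof.
case/andP=> s0 s1; have H := dotp_ge0 (v - u).
have {H} : 0 <= s * (1 - s) * dotp (v - u) (v - u).
  by rewrite !mulr_ge0 ?subr_ge0.
rewrite !dotpE (dotpC v u); lra.
Qed.

(** The Gram determinant of [e], [p] dominates the component of [p] orthogonal
to [e]: this is Bessel's inequality for the orthogonal pair [e], [g], stated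
without dividing so that [e = 0] is allowed. *)
Lemma bessel2 e p g : dotp e g = 0 ->
  dotp e e * dotp p g ^+ 2 <=
  dotp g g * (dotp e e * dotp p p - dotp e p ^+ 2).
Proof.
move=> eg.
have [->|e0] := eqVneq e 0; first by rewrite !dotp0l !mul0r expr0n subrr mulr0.
have [->|g0] := eqVneq g 0.
  by rewrite dotpC !dotp0l expr0n /= mulr0 mul0r.
have ee := dotp_gt0 e0; have gg := dotp_gt0 g0.
have := dotp_ge0 ((dotp e e * dotp g g) *: p - (dotp g g * dotp e p) *: e
                  - (dotp e e * dotp p g) *: g).
rewrite !dotpE (dotpC p e) (dotpC g e) (dotpC g p) eg.
move: ee gg; set a := dotp e e; set b := dotp g g; set c := dotp p p.
set d := dotp e p; set f := dotp p g => a0 b0 H.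
have {H} : 0 <= (a * b) * (b * (a * c - d ^+ 2) - a * f ^+ 2) by lra.
by rewrite pmulr_rge0 ?mulr_gt0 // subr_ge0.
Qed.

Lemma dotp_delta u i : dotp u (delta_mx 0 i) = u 0 i.
Proof.
rewrite /dotp (bigD1 i) //= big1 ?addr0; first by rewrite mxE !eqxx mulr1.
by move=> j ji; rewrite mxE (negbTE ji) andbF mulr0.
Qed.

Lemma exists_orthogonal e : (2 <= n)%N -> exists2 f, f != 0 & dotp e f = 0.
Proof.
move=> hn; pose i0 := Ordinal (leq_trans (isT : (0 < 2)%N) hn).
pose i1 := Ordinal hn.
have [e00|e00] := eqVneq (e 0 i0) 0.
  exists (delta_mx 0 i0); last by rewrite dotp_delta.
  apply/negP => /eqP/rowP/(_ i0); rewrite !mxE !eqxx /= => /eqP.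
  by rewrite oner_eq0.
exists (e 0 i1 *: delta_mx 0 i0 - e 0 i0 *: delta_mx 0 i1); last first.
  by rewrite !dotpE !dotp_delta mulrC subrr.
apply/negP => /eqP/rowP/(_ i1); rewrite !mxE !eqxx /= mulr0 mulr1 sub0r.
by move/eqP; rewrite oppr_eq0 (negbTE e00).
Qed.

End Euclidean.

(** * Inverse trigonometric functions *)

Section InverseTrig.
Context {R : realType}.
Implicit Types c d s v : R.

Lemma ler_acos c d : -1 <= c -> c <= d -> d <= 1 -> acos d <= acos c.
Proof.
move=> c1 cd d1; have cI : -1 <= c <= 1 by rewrite c1 (le_trans cd).
have dI : -1 <= d <= 1 by rewrite d1 (le_trans c1).
rewrite leNgt -ltr_cos ?in_itv/= ?acos_ge0 ?acos_lepi //.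
by rewrite !acosK ?in_itv //= -leNgt.
Qed.

Lemma asin_ge0 s : 0 <= s <= 1 -> 0 <= asin s.
Proof.
move=> /andP[s0 s1]; have sI : -1 <= s <= 1 by rewrite s1 andbT; lra.
have pi0 := pi_gt0 R.
rewrite leNgt -ltr_sin ?in_itv/= ?asin_geNpi2 ?asin_lepi2 ?andbT //; last lra.
by rewrite asinK ?in_itv //= sin0 -leNgt.
Qed.

Lemma asin_le_of_le_sin s v : -1 <= s -> 0 <= v <= pi / 2 -> s <= sin v ->
  asin s <= v.
Proof.
move=> s0 /andP[v0 v1] sv.
have sI : -1 <= s <= 1 by rewrite s0 (le_trans sv (sin_le1 _)).
rewrite leNgt -ltr_sin ?in_itv/= ?asin_geNpi2 ?asin_lepi2 ?andbT //; last first.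
  by rewrite v1 andbT; have := pi_gt0 R; lra.
by rewrite asinK ?in_itv //= -leNgt.
Qed.

Lemma asin_acos_sqrt s : 0 <= s <= 1 -> asin s = acos (Num.sqrt (1 - s ^+ 2)).
Proof.
move=> sI; have /andP[s0 s1] := sI.
have sI' : -1 <= s <= 1 by rewrite s1 andbT; lra.
rewrite -cos_asin // cosK // in_itv /= asin_ge0 //=.
by have := asin_lepi2 sI'; have := pi_gt0 R; lra.
Qed.

Lemma double_asin s : 0 <= s <= 1 -> 2 * asin s = acos (1 - 2 * s ^+ 2).
Proof.
move=> sI; have /andP[s0 s1] := sI.
have sI' : -1 <= s <= 1 by rewrite s1 andbT; lra.
have -> : 1 - 2 * s ^+ 2 = cos (2 * asin s).
  rewrite (mulr_natl (asin s)) cos_mulr2n cos2sin2 asinK ?in_itv //=; ring.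
rewrite cosK // in_itv /= mulr_ge0 ?asin_ge0 //=.
by have := asin_lepi2 sI'; lra.
Qed.

End InverseTrig.

(** * Angles *)

Section Angles.
Context {R : realType} {n : nat}.
Implicit Types (u v e p g x y z w : 'rV[R]_n) (c m : R).

Lemma angle_sym x z y : angle x z y = angle y z x.
Proof. by rewrite /angle dotpC (mulrC (enorm _)). Qed.

Lemma angle_cos_bounds u v : -1 <= dotp u v / (enorm u * enorm v) <= 1.
Proof.
have [->|u0] := eqVneq u 0; first by rewrite dotp0l mul0r lerN10 ler01.
have [->|v0] := eqVneq v 0.
  by rewrite dotpC dotp0l mul0r lerN10 ler01.
have uv0 : 0 < enorm u * enorm v by rewrite mulr_gt0 ?enorm_gt0.
rewrite ler_pdivlMr // ler_pdivrMr // mulN1r mul1r.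
by have := cauchy_schwarz u v; rewrite ler_norml.
Qed.

Lemma angle_le_acos x z y c : z != x -> z != y -> -1 <= c ->
  c * (enorm (x - z) * enorm (y - z)) <= dotp (x - z) (y - z) ->
  angle x z y <= acos c.
Proof.
move=> zx zy c1 H; apply: ler_acos => //; last first.
  by have /andP[] := angle_cos_bounds (x - z) (y - z).
by rewrite ler_pdivlMr // mulr_gt0 // enorm_gt0 // subr_eq0 eq_sym.
Qed.

Lemma acos_le_angle x z y c : z != x -> z != y -> c <= 1 ->
  dotp (x - z) (y - z) <= c * (enorm (x - z) * enorm (y - z)) ->
  acos c <= angle x z y.
Proof.
move=> zx zy c1 H; apply: ler_acos => //.
  by have /andP[] := angle_cos_bounds (x - z) (y - z).
by rewrite ler_pdivrMr // mulr_gt0 // enorm_gt0 // subr_eq0 eq_sym.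
Qed.

Lemma angle_bounds x z y : 0 <= angle x z y <= pi.
Proof. by rewrite acos_ge0 ?acos_lepi ?angle_cos_bounds. Qed.

(** A version of the inscribed angle theorem.  Centre the coordinates at the
midpoint of [[x, y]], so that [x] and [y] become [- e] and [e]; the ball
with centre [g], orthogonal to [e], and with [x] and [y] on its boundary sphere
has radius [r] with [r ^ 2 = |g| ^ 2 + |e| ^ 2], and membership of [p] in it
simplifies to [|p| ^ 2 - |e| ^ 2 <= 2 (p . g)].  The left side is the inner
product of [- e - p] and [e - p], so Bessel's inequality applied to their Gram
determinant bounds the cosine of the angle at [p] by [|g| / r]. *)
Lemma angle_ge_in_ball x y w e p g :
  x - w = - e - p -> y - w = e - p -> w != x -> w != y -> dotp e g = 0 ->
  g != 0 -> dotp p p - dotp e e <= 2 * dotp p g ->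
  acos (enorm g / Num.sqrt (dotp g g + dotp e e)) <= angle x w y.
Proof.
move=> xw yw wx wy eg g0 Hp.
have gg := dotp_gt0 g0; have ee := dotp_ge0 e.
set r := Num.sqrt _.
have r0 : 0 < r by rewrite sqrtr_gt0 ltr_pwDl.
have r2 : r ^+ 2 = dotp g g + dotp e e by rewrite sqr_sqrtr // addr_ge0 // ltW.
have gr : enorm g <= r by rewrite ler_wsqrtr // lerDl.
apply: acos_le_angle => //; first by rewrite ler_pdivrMr // mul1r.
rewrite mulrAC ler_pdivlMr //.
set u := x - w; set v := y - w.
have uvE : dotp u v = dotp p p - dotp e e.
  by rewrite /u /v xw yw !dotpE (dotpC p e); lra.
have H0 : 0 <= enorm g * (enorm u * enorm v) by rewrite !mulr_ge0 ?enorm_ge0.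
have [uv|uv] := leP (dotp u v) 0.
  by rewrite (le_trans _ H0) // mulr_le0_ge0 // ltW.
rewrite -(ler_pXn2r (isT : (0 < 2)%N)) ?nnegrE ?mulr_ge0 ?enorm_ge0
  ?(ltW uv) ?(ltW r0) //.
rewrite !exprMn !enorm_sqr r2.
have -> : dotp u u * dotp v v =
    dotp u v ^+ 2 + 4 * (dotp e e * dotp p p - dotp e p ^+ 2).
  by rewrite /u /v xw yw !dotpE (dotpC p e); ring.
have HB := bessel2 p eg.
rewrite -uvE in Hp.
have Hq : dotp u v ^+ 2 <= 4 * dotp p g ^+ 2.
  have -> : 4 * dotp p g ^+ 2 = (2 * dotp p g) ^+ 2 by ring.
  by rewrite ler_pXn2r ?nnegrE ?(ltW uv) // (le_trans (ltW uv)).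
have := ler_wpM2l ee Hq.
move: HB; set G := dotp g g; set E := dotp e e; set F := dotp p g ^+ 2.
set B := _ - dotp e p ^+ 2; set D := dotp u v ^+ 2; clearbody G E F B D.
by move=> *; lra.
Qed.

(** The point dividing [[x, y]] in the ratio [|x - z| : |y - z|] lies on the
bisector of the angle at [z]; knowing only that its distance to [z] is at least
[m] already bounds the angle by [2 arctan (|x - y| / (2 m))], whose cosine is
the quotient below. *)
Lemma angle_le_away_from_segment x y z m : 0 < m -> z != x -> z != y ->
  (forall s, 0 <= s <= 1 -> m <= enorm (x + s *: (y - x) - z)) ->
  angle x z y <= acos ((4 * m ^+ 2 - dotp (x - y) (x - y))
                        / (4 * m ^+ 2 + dotp (x - y) (x - y))).
Proof.
move=> m0 zx zy Hs.
have aa := dotp_ge0 (x - y); have m2 : 0 < m ^+ 2 by rewrite exprn_gt0.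
have d0 : 0 < 4 * m ^+ 2 + dotp (x - y) (x - y) by lra.
apply: angle_le_acos => //; first by rewrite ler_pdivlMr //; lra.
rewrite mulrAC ler_pdivrMr //.
set u := x - z; set v := y - z; set a := enorm u; set b := enorm v.
have a0 : 0 < a by rewrite enorm_gt0 // subr_eq0 eq_sym.
have b0 : 0 < b by rewrite enorm_gt0 // subr_eq0 eq_sym.
have ab0 : 0 < a + b by rewrite addr_gt0.
have xyE : x - y = u - v by rewrite /u /v opprB addrA subrK.
have segE s : x + s *: (y - x) - z = u + s *: (v - u).
  by apply/rowP => i; rewrite !mxE; ring.
rewrite xyE in aa d0 *; clearbody u v.
have uvE : dotp (u - v) (u - v) = a ^+ 2 + b ^+ 2 - 2 * dotp u v.
  by rewrite !enorm_sqr !dotpE (dotpC v u); ring.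
(* The hypothesis at the foot of the bisector. *)
have Hw : m ^+ 2 * (a + b) ^+ 2 <= 2 * (a * b) * (a * b + dotp u v).
  have /Hs : 0 <= a / (a + b) <= 1.
    by rewrite divr_ge0 ?(ltW a0) ?(ltW ab0) //= ler_pdivrMr // mul1r lerDl ltW.
  have -> : x + (a / (a + b)) *: (y - x) - z =
      (a + b)^-1 *: (b *: u + a *: v).
    rewrite segE; apply/rowP => i; rewrite !mxE; field.
    by rewrite gt_eqF.
  rewrite enormZ gtr0_norm ?invr_gt0 // ler_pdivlMl // => Hm.
  have mab : 0 <= m * (a + b) by rewrite mulr_ge0 ?ltW.
  have {Hm} : (m * (a + b)) ^+ 2 <= enorm (b *: u + a *: v) ^+ 2.
    by rewrite ler_pXn2r ?nnegrE ?enorm_ge0 // mulrC.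
  rewrite enorm_sqr exprMn !dotpE (dotpC v u) -!enorm_sqr -/a -/b; lra.
have := cauchy_schwarz u v; rewrite ler_norml -/a -/b => /andP[D1 D2].
rewrite uvE; set D := dotp u v in Hw D1 D2 *.
suff : 0 <= (a ^+ 2 + b ^+ 2 - 2 * D) * (a * b + D) - 4 * m ^+ 2 * (a * b - D).
  lra.
have ab2 : 0 < (a + b) ^+ 2 by rewrite exprn_gt0.
rewrite -(pmulr_lge0 _ ab2).
(* Multiplied by [(a + b) ^ 2], the claim is [H2] plus four times [H1]; the
   latter is [Hw] scaled by the nonnegative factor [a * b - D]. *)
have H1 : 0 <= (a * b - D) * (2 * (a * b) * (a * b + D) - m ^+ 2 * (a + b) ^+ 2).
  by rewrite mulr_ge0 ?subr_ge0.
have H2 : 0 <= (a * b + D) * ((a - b) ^+ 2 * (a + b) ^+ 2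
     + 2 * (a * b - D) * (a - b) ^+ 2).
  rewrite mulr_ge0 //; first by lra.
  apply: addr_ge0; first exact: mulr_ge0 (sqr_ge0 _) (sqr_ge0 _).
  by apply: mulr_ge0 (sqr_ge0 _); lra.
lra.
Qed.

End Angles.

(** * Segments and boundaries *)

Section Segments.
Context {R : realType} {n : nat}.
Implicit Types (G : set 'rV[R]_n) (x y q z p : 'rV[R]_n) (s r : R).

Lemma convex_set_segment G x y s : convex_set G -> G x -> G y ->
  0 <= s <= 1 -> G (x + s *: (y - x)).
Proof.
move=> cG Gx Gy /andP[s0 s1].
have := cG y x (Itv01 s0 s1); rewrite !inE => /(_ Gy Gx).
congr (G _); rewrite /conv /= /unstable.onem.
by apply/rowP => i; rewrite !mxE; ring.
Qed.

Lemma segment_convex_set G :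
  (forall x y s, G x -> G y -> 0 <= s <= 1 -> G (x + s *: (y - x))) ->
  convex_set G.
Proof.
move=> H x y s; rewrite !inE => Gx Gy.
have := H y x s%:num Gy Gx; rewrite ge0 le1 => /(_ isT).
congr (G _); rewrite /conv /= /unstable.onem.
by apply/rowP => i; rewrite !mxE; ring.
Qed.

Definition segment x y : set 'rV[R]_n :=
  [set x + s *: (y - x) | s in [set s | 0 <= s <= 1]].

Lemma segment_start x y : segment x y x.
Proof. by exists 0; rewrite /= ?lexx ?ler01 // scale0r addr0. Qed.

Lemma segment_end x y : segment x y y.
Proof. by exists 1; rewrite /= ?lexx ?ler01 // scale1r addrC subrK. Qed.

Lemma connected_segment x y : connected (segment x y).
Proof.
apply: connected_continuous_connected.
  apply/connected_intervalP => a b /= /andP[a0 a1] /andP[b0 b1] c /andP[ac cb].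
  by rewrite (le_trans a0 ac) (le_trans cb b1).
apply: continuous_subspaceT => s.
by apply: cvgD; [exact: cvg_cst | exact: scalel_continuous].
Qed.

Lemma convex_connected G x : convex_set G -> G x -> connected G.
Proof.
move=> cG Gx; have -> : G = \bigcup_(y in G) segment x y.
  apply/seteqP; split=> [y Gy|p [y Gy [s s01 <-]]].
    by exists y => //; exact: segment_end.
  exact: convex_set_segment.
apply: bigcup_connected => [|y _]; last exact: connected_segment.
by exists x => y _; exact: segment_start.
Qed.

Lemma boundary_open_notin G z : open G -> boundary G z -> ~ G z.
Proof. by move=> /interior_id oG [_]; rewrite oG. Qed.

(** Otherwise [G] and its closure have the same trace on the segment, which is
then open, closed and nonempty in a connected set. *)
Lemma segment_meets_boundary G x q : open G -> G x -> ~ G q ->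
  exists2 s, 0 <= s <= 1 & boundary G (x + s *: (q - x)).
Proof.
move=> oG Gx Gq; apply: contrapT => nB; apply: Gq.
have clG : segment x q `&` G = segment x q `&` closure G.
  apply/seteqP; split=> p [[s s01 <-] Gp]; split; try by exists s.
    exact: subset_closure.
  apply: contrapT => nG; apply: nB; exists s => //; split=> //.
  by rewrite (interior_id G).1.
have : segment x q `&` G = segment x q.
  apply: (@connected_segment x q); first by exists x; split=> //; exact: segment_start.
  - by exists G.
  - by exists (closure G) => //; exact: closed_closure.
by move/seteqP => [_ /(_ q (segment_end _ _))[]].
Qed.

Lemma boundary_nonempty G x : open G -> G x -> G != setT ->
  boundary G !=set0.
Proof.
move=> oG Gx /eqP GT.
have [q Gq] : exists q, ~ G q.
  apply: contrapT => H; apply: GT; apply/seteqP; split=> // q _.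
  by apply: contrapT => Gq; apply: H; exists q.
by have [s _ Bs] := segment_meets_boundary oG Gx Gq; eexists; exact: Bs.
Qed.

Lemma mx_norm_le_enorm x : `|x| <= enorm x.
Proof.
rewrite [`|x|]mx_normrE; apply: bigmax_le => [|[i j] _] /=.
  exact: enorm_ge0.
by rewrite ord1 normr_coord_le_enorm.
Qed.

Lemma open_enorm_ball G x : open G -> G x ->
  exists2 r, 0 < r & forall z, ~ G z -> r <= enorm (x - z).
Proof.
move=> oG Gx; have /nbhs_ballP[r r0 rG] : nbhs x G by exact: open_nbhs_nbhs.
exists r => // z; rewrite leNgt => Gz; apply/negP => xz; apply: Gz; apply: rG.
by rewrite -ball_normE /= (le_lt_trans (mx_norm_le_enorm _)).
Qed.

Lemma dist_boundary_le G x z : boundary G z ->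
  dist_boundary G x <= enorm (x - z).
Proof.
move=> Bz; apply: ge_inf; last by exists z.
by exists 0 => _ [w _ <-]; exact: enorm_ge0.
Qed.

Lemma le_dist_boundary G x r : boundary G !=set0 ->
  (forall z, boundary G z -> r <= enorm (x - z)) -> r <= dist_boundary G x.
Proof.
move=> [z Bz] H; apply: lb_le_inf; first by exists (enorm (x - z)), z.
by move=> _ [w Bw <-]; exact: H.
Qed.

Lemma dist_boundary_gt0 G x : open G -> boundary G !=set0 -> G x ->
  0 < dist_boundary G x.
Proof.
move=> oG B0 Gx; have [r r0 H] := open_enorm_ball oG Gx.
apply: (lt_le_trans r0); apply: le_dist_boundary => // z /(boundary_open_notin oG).
exact: H.
Qed.

Lemma enorm_ball_subset G x p : open G -> G x ->
  enorm (p - x) < dist_boundary G x -> G p.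
Proof.
move=> oG Gx px; apply: contrapT => Gp.
have [s /andP[s0 s1] /(dist_boundary_le x)] := segment_meets_boundary oG Gx Gp.
rewrite opprD addrA subrr sub0r enormN enormZ ger0_norm //.
by apply/negP; rewrite -ltNge (le_lt_trans _ px) // ler_piMl // enorm_ge0.
Qed.

(** In a convex set, the distance to the boundary is quasiconcave: translating
[z] back along the segment sends a boundary point closer than [m] into the balls
of radius [m] around both ends. *)
Lemma boundary_away_from_segment G x y z m s :
  open G -> convex_set G -> G x -> G y -> boundary G z ->
  m <= dist_boundary G x -> m <= dist_boundary G y -> 0 <= s <= 1 ->
  m <= enorm (x + s *: (y - x) - z).
Proof.
move=> oG cG Gx Gy Bz mx my s01; rewrite leNgt; apply/negP => lt_m.
set d := x + _ - z in lt_m.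
apply: (boundary_open_notin oG Bz).
have GB p : G p -> m <= dist_boundary G p -> G (p - d).
  move=> Gp mp; apply: (enorm_ball_subset oG Gp).
  by rewrite addrAC subrr sub0r enormN (lt_le_trans lt_m).
have -> : z = (x - d) + s *: ((y - d) - (x - d)).
  by apply/rowP => i; rewrite !mxE; ring.
by apply: convex_set_segment => //; exact: GB.
Qed.

End Segments.

(** * The two inequalities *)

Section Bounds.
Context {R : realType} {n : nat}.
Implicit Types (G : set 'rV[R]_n) (x y z : 'rV[R]_n).

Lemma visual_angle_sym G x y : visual_angle G x y = visual_angle G y x.
Proof.
by rewrite /visual_angle; congr sup; apply: eq_imagel => z _; exact: angle_sym.
Qed.

Lemma angle_le_visual G x y z : boundary G z -> angle x z y <= visual_angle G x y.
Proof.
move=> Bz; apply: ub_le_sup; last by exists z.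
by exists pi => _ [w _ <-]; have /andP[] := angle_bounds x w y.
Qed.

Lemma visual_angle_le G x y r : boundary G !=set0 ->
  (forall z, boundary G z -> angle x z y <= r) -> visual_angle G x y <= r.
Proof.
move=> [z Bz] H; apply: ge_sup; first by exists (angle x z y), z.
by move=> _ [w Bw <-]; exact: H.
Qed.

Lemma expR_dist_ratio G x y : open G -> boundary G !=set0 -> G x -> G y ->
  expR (dist_ratio G x y) - 1 =
  enorm (x - y) / Num.min (dist_boundary G x) (dist_boundary G y).
Proof.
move=> oG B0 Gx Gy; rewrite /dist_ratio.
set q := _ / _; rewrite (lnK (x := 1 + q)); first by rewrite addrC addKr.
rewrite posrE ltr_pwDl // divr_ge0 ?enorm_ge0 //.
by rewrite le_min !(ltW (dist_boundary_gt0 oG B0 _)).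
Qed.

(** The set of points seeing [[x, y]] under an angle of at least
[asin (a / (a + 2 r))], where [a = |x - y|], contains every ball of radius
[r + a / 2] with [x] and [y] on its sphere; two of them have centres [M + g] and
[M - g], where [M] is the midpoint of [x] and [y].  If [|x - z| = r], then
[|z - M| <= r + a / 2], so that [z + g] and [z - g] lie in these two balls.  As
[z] is outside the convex set [G], so is one of these two points; the segment
joining it to [x] stays in the same ball and crosses the boundary. *)
Lemma visual_angle_ge_boundary_point G x y z : (2 <= n)%N ->
  open G -> convex_set G -> G x -> G y -> boundary G z ->
  asin (enorm (x - y) / (enorm (x - y) + 2 * enorm (x - z)))
    <= visual_angle G x y.
Proof.
move=> hn oG cG Gx Gy Bz.
have Gz := boundary_open_notin oG Bz.
set a := enorm (x - y); set r := enorm (x - z).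
have a0 : 0 <= a := enorm_ge0 _.
have r0 : 0 < r.
  rewrite enorm_gt0 // subr_eq0; apply/eqP => xz; by apply: Gz; rewrite -xz.
have [e eE] : exists e, e = 2^-1 *: (y - x) by eexists.
have [M ME] : exists M, M = x + e by eexists.
have [f f0 ef] := exists_orthogonal e hn.
(* The balls have squared radius [h ^ 2 + (a / 2) ^ 2 = (r + a / 2) ^ 2]. *)
pose h := Num.sqrt (r * (r + a)).
have h0 : 0 < h by rewrite sqrtr_gt0 mulr_gt0 // ltr_pwDl.
have h2 : h ^+ 2 = r * (r + a).
  by rewrite sqr_sqrtr // mulr_ge0 // ?addr_ge0 // ltW.
have [g gN eg] : exists2 g, enorm g = h & dotp e g = 0.
  exists ((h / enorm f) *: f); last by rewrite dotpZr ef mulr0.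
  rewrite enormZ gtr0_norm ?divr_gt0 ?enorm_gt0 // divfK //.
  by rewrite gt_eqF // enorm_gt0.
have gg : dotp g g = r * (r + a) by rewrite -enorm_sqr gN.
have eN : enorm e = a / 2.
  by rewrite eE enormZ enormB mulrC ger0_norm.
have ee : dotp e e = a ^+ 2 / 4 by rewrite -enorm_sqr eN; field.
have zM : dotp (z - M) (z - M) <= (r + a / 2) ^+ 2.
  rewrite -enorm_sqr ler_pXn2r ?nnegrE ?enorm_ge0 ?addr_ge0 ?divr_ge0 ?(ltW r0) //.
  have -> : z - M = (z - x) - e by rewrite ME opprD addrA.
  by rewrite (le_trans (ler_enormD _ _)) // enormN eN enormB.
have key g' : dotp e g' = 0 -> dotp g' g' = dotp g g -> ~ G (z + g') ->
    asin (a / (a + 2 * r)) <= visual_angle G x y.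
  move=> eg' gg' Gq.
  have [s s01 Bw] := segment_meets_boundary oG Gx Gq.
  apply: le_trans (angle_le_visual x y Bw).
  set w := x + _ in Bw *.
  have Gw := boundary_open_notin oG Bw.
  have g'N : enorm g' = h by rewrite -gN /enorm gg'.
  have wx : w != x by apply/eqP => wx; apply: Gw; rewrite wx.
  have wy : w != y by apply/eqP => wy; apply: Gw; rewrite wy.
  have g'0 : g' != 0.
    by apply/eqP => g'0; move: h0; rewrite -g'N g'0 enorm0 ltxx.
  have ball : dotp (w - M) (w - M) - dotp e e <= 2 * dotp (w - M) g'.
    suff : dotp (w - M - g') (w - M - g') <= dotp g' g' + dotp e e.
      by move: (w - M) => p; rewrite !dotpE (dotpC g' p); lra.
    (* Seen from the centre of the ball, [w] lies between [x] and [z + g']. *)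
    have -> : w - M - g' = (- e - g') + s *: ((z - M) - (- e - g')).
      by rewrite /w ME; apply/rowP => i; rewrite !mxE; ring.
    apply: (le_trans (dotp_segment_le _ _ s01)).
    have -> : dotp (- e - g') (- e - g') = dotp g' g' + dotp e e.
      by rewrite !dotpE (dotpC g' e) eg'; ring.
    have : dotp (z - M) (z - M) <= dotp g' g' + dotp e e.
      by rewrite gg' gg ee; apply: (le_trans zM); lra.
    case/andP: s01 => s0 s1 /(ler_wpM2l s0); lra.
  have xw : x - w = - e - (w - M).
    by rewrite ME; apply/rowP => i; rewrite !mxE; ring.
  have yw : y - w = e - (w - M).
    by rewrite ME eE; apply/rowP => i; rewrite !mxE; field.
  have := angle_ge_in_ball xw yw wx wy eg' g'0 ball.
  have d0 : 0 < a + 2 * r by rewrite ltr_wpDl // mulr_gt0.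
  have sI : 0 <= a / (a + 2 * r) <= 1.
    rewrite divr_ge0 ?(ltW d0) //= ler_pdivrMr // mul1r lerDl.
    by rewrite mulr_ge0 ?(ltW r0).
  rewrite asin_acos_sqrt // g'N gg' gg ee.
  have -> : r * (r + a) + a ^+ 2 / 4 = ((a + 2 * r) / 2) ^+ 2 by field.
  rewrite sqrtr_sqr ger0_norm ?divr_ge0 ?(ltW d0) //.
  suff -> : 1 - (a / (a + 2 * r)) ^+ 2 = (h / ((a + 2 * r) / 2)) ^+ 2.
    by rewrite sqrtr_sqr ger0_norm // divr_ge0 ?(ltW h0) // divr_ge0 ?(ltW d0).
  rewrite !expr_div_n h2; field.
  by rewrite gt_eqF.
have [Gq|Gq] := pselect (G (z + g)); last exact: (key g).
apply: (key (- g)); rewrite ?dotpE ?eg ?oppr0 ?opprK // => Gq'.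
apply: Gz.
have -> : z = (z + g) + 2^-1 *: ((z - g) - (z + g)).
  by apply/rowP => i; rewrite !mxE; field.
by apply: convex_set_segment => //; lra.
Qed.

(** The previous bound tends to this one along a minimizing sequence of boundary
points.  Below a right angle it can be solved for the distance [|x - z|], which
is thus bounded below uniformly in [z], and the infimum passes through. *)
Lemma visual_angle_ge_dist_boundary G x y : (2 <= n)%N ->
  open G -> convex_set G -> G x -> G y -> boundary G !=set0 ->
  asin (enorm (x - y) / (enorm (x - y) + 2 * dist_boundary G x))
    <= visual_angle G x y.
Proof.
move=> hn oG cG Gx Gy B0.
set a := enorm _; set V := visual_angle G x y; set m := dist_boundary G x.
have m0 : 0 < m := dist_boundary_gt0 oG B0 Gx.
have V0 : 0 <= V.
  have [z Bz] := B0; apply: le_trans (angle_le_visual x y Bz).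
  by have /andP[] := angle_bounds x z y.
have a0 : 0 <= a := enorm_ge0 _.
have sI d : 0 < d -> 0 <= a / (a + 2 * d) <= 1.
  move=> d0; have ad : 0 < a + 2 * d by lra.
  rewrite divr_ge0 ?(ltW ad) //= ler_pdivrMr // mul1r; lra.
have sI' d : 0 < d -> -1 <= a / (a + 2 * d) <= 1.
  by move=> /sI/andP[]; lra.
have [Vpi|Vpi] := leP (pi / 2) V; first exact: le_trans (asin_lepi2 (sI' _ m0)) Vpi.
have ad : 0 < a + 2 * m by lra.
apply: asin_le_of_le_sin; rewrite ?V0 ?(ltW Vpi) //; first by have /andP[] := sI' _ m0.
rewrite ler_pdivrMr //.
have [->|an0] := eqVneq a 0.
  by rewrite mulr_ge0 ?sin_ge0_pi ?V0 //; have := pi_gt0 R; lra.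
have {}a0 : 0 < a by rewrite lt_neqAle eq_sym an0.
have HS z : boundary G z -> a <= sin V * (a + 2 * enorm (x - z)).
  move=> Bz; have mz := lt_le_trans m0 (dist_boundary_le x Bz).
  rewrite -ler_pdivrMr; last lra.
  have /andP[s1 s2] := sI' _ mz.
  have H := visual_angle_ge_boundary_point hn oG cG Gx Gy Bz.
  rewrite -[leLHS]asinK ?in_itv /= ?s1 // leNgt.
  rewrite ltr_sin ?in_itv /= ?asin_geNpi2 ?asin_lepi2 ?sI' // -?leNgt //.
  by rewrite (ltW Vpi) andbT; have := pi_gt0 R; lra.
have S0 : 0 < sin V.
  have [z Bz] := B0.
  rewrite ltNge; apply/negP => S0; have := HS z Bz; apply/negP; rewrite -ltNge.
  apply: le_lt_trans a0; rewrite mulr_le0_ge0 //.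
  by rewrite addr_ge0 ?(enorm_ge0) // mulr_ge0 ?enorm_ge0.
suff : (a / sin V - a) / 2 <= m.
  rewrite ler_pdivrMr // lerBlDr ler_pdivrMr //; lra.
apply: le_dist_boundary => // z /HS.
by rewrite ler_pdivrMr // lerBlDr ler_pdivrMr //; lra.
Qed.

Lemma visual_angle_lower G x y : (2 <= n)%N ->
  proper_convex_domain G -> G x -> G y ->
  let t := expR (dist_ratio G x y) - 1 in
  asin (t / (t + 2)) <= visual_angle G x y.
Proof.
move=> hn [[_ oG _] cG GT] Gx Gy.
have B0 := boundary_nonempty oG Gx GT.
rewrite /= expR_dist_ratio //.
have red a m : 0 < m -> 0 <= a -> a / m / (a / m + 2) = a / (a + 2 * m) :> R.
  move=> m0 a0; have am : 0 < a + 2 * m by lra.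
  by field; rewrite gt_eqF // gt_eqF.
have dx := dist_boundary_gt0 oG B0 Gx; have dy := dist_boundary_gt0 oG B0 Gy.
rewrite red ?enorm_ge0 //; last by rewrite lt_min dx.
have [_|_] := leP (dist_boundary G x) (dist_boundary G y).
  exact: visual_angle_ge_dist_boundary.
by rewrite visual_angle_sym enormB; exact: visual_angle_ge_dist_boundary.
Qed.

Lemma visual_angle_upper G x y :
  proper_convex_domain G -> G x -> G y ->
  let t := expR (dist_ratio G x y) - 1 in
  visual_angle G x y <= 2 * asin (t / Num.sqrt (4 + t ^+ 2)).
Proof.
move=> [[_ oG _] cG GT] Gx Gy.
have B0 := boundary_nonempty oG Gx GT.
rewrite /= expR_dist_ratio //.
set m := Num.min _ _; set a := enorm _.
have m0 : 0 < m by rewrite lt_min !dist_boundary_gt0.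
have a0 : 0 <= a := enorm_ge0 _.
set t := a / m.
have t0 : 0 <= t by rewrite divr_ge0 // ltW.
have t2 := sqr_ge0 t.
have d0 : 0 < 4 + t ^+ 2 by lra.
rewrite double_asin; last first.
  rewrite divr_ge0 ?sqrtr_ge0 //= ler_pdivrMr ?sqrtr_gt0 // mul1r.
  by rewrite -[leLHS]ger0_norm // -sqrtr_sqr ler_wsqrtr //; lra.
rewrite expr_div_n sqr_sqrtr ?(ltW d0) //.
have -> : 1 - 2 * (t ^+ 2 / (4 + t ^+ 2)) =
    (4 * m ^+ 2 - dotp (x - y) (x - y)) / (4 * m ^+ 2 + dotp (x - y) (x - y)).
  have a2 := sqr_ge0 a; have m2 : 0 < m ^+ 2 by rewrite exprn_gt0.
  rewrite -enorm_sqr -/a /t; field.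
  by rewrite !gt_eqF //; lra.
apply: visual_angle_le => // z Bz.
have Gz := boundary_open_notin oG Bz.
apply: angle_le_away_from_segment => //.
- by apply/eqP => zx; apply: Gz; rewrite zx.
- by apply/eqP => zy; apply: Gz; rewrite zy.
- move=> s s01; apply: (boundary_away_from_segment oG cG) => //.
    by rewrite ge_min lexx.
  by rewrite ge_min lexx orbT.
Qed.

End Bounds.

(** * Half-spaces and the extremal configurations *)

Section HalfSpace.
Context {R : realType} {n : nat}.
Context (i0 : 'I_n).
Implicit Types u z : 'rV[R]_n.

Definition halfspace : set 'rV[R]_n := [set u | 0 < u 0 i0].

Lemma halfspace_open : open halfspace.
Proof.
apply: (@open_comp _ _ (fun u : 'rV[R]_n => u 0 i0) [set r | 0 < r]).
  by move=> u _; exact: coord_continuous.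
exact: open_gt.
Qed.

Lemma halfspace_convex : convex_set halfspace.
Proof.
apply: segment_convex_set => x y s; rewrite /halfspace /= !mxE.
move=> x0 y0 /andP[]; rewrite le_eqVlt => /orP[/eqP<- _|s0 s1].
  by rewrite mul0r addr0.
have := mulr_gt0 s0 y0; have := mulr_ge0 (_ : 0 <= 1 - s) (ltW x0).
by rewrite subr_ge0 => /(_ s1); lra.
Qed.

Lemma halfspace_boundaryE z : boundary halfspace z <-> z 0 i0 = 0.
Proof.
split=> [Bz|z0].
  have := boundary_open_notin halfspace_open Bz; rewrite /halfspace /= => /negP.
  rewrite -leNgt => z0; apply/eqP; rewrite eq_le z0 /=.
  have clH : closed [set u : 'rV[R]_n | 0 <= u 0 i0].
    apply: (@preimage_closed _ _ (fun u : 'rV[R]_n => u 0 i0) [set r | 0 <= r]).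
      by move=> u _; exact: coord_continuous.
    exact: closed_ge.
  have [clz _] := Bz; apply: (clH z); apply: closure_subset clz.
  by move=> u /ltW.
pose x := z + delta_mx 0 i0 : 'rV[R]_n.
have x0 : halfspace x by rewrite /halfspace /= !mxE !eqxx z0 add0r ltr01.
have Hz : ~ halfspace z by rewrite /halfspace /= z0 ltxx.
have [s s01 Bs] := segment_meets_boundary halfspace_open x0 Hz.
have := boundary_open_notin halfspace_open Bs.
rewrite /halfspace /= !mxE !eqxx z0 /= => /negP.
move: s01 => /andP[_ s1]; rewrite -leNgt => Hs.
have s1' : s = 1 by lra.
by move: Bs; rewrite s1' scale1r addrC subrK.
Qed.

Lemma halfspace_boundary0 : boundary halfspace 0.
Proof. by apply/halfspace_boundaryE; rewrite mxE. Qed.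

Lemma halfspace_proper u : halfspace u -> proper_convex_domain halfspace.
Proof.
move=> Hu; split.
- split; [by exists u | exact: halfspace_open |].
  exact: convex_connected halfspace_convex Hu.
- exact: halfspace_convex.
- apply/eqP => HT; have : halfspace 0 by rewrite HT.
  by rewrite /halfspace /= mxE ltxx.
Qed.

Lemma halfspace_dist u : halfspace u -> dist_boundary halfspace u = u 0 i0.
Proof.
move=> Hu; apply/eqP; rewrite eq_le; apply/andP; split; last first.
  apply: le_dist_boundary; first by exists 0; exact: halfspace_boundary0.
  move=> z /halfspace_boundaryE z0; apply: le_trans (normr_coord_le_enorm _ i0).
  by rewrite !mxE z0 subr0 ler_norm.
have Bz : boundary halfspace (u - u 0 i0 *: delta_mx 0 i0).
  by apply/halfspace_boundaryE; rewrite !mxE !eqxx /= mulr1 subrr.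
apply: le_trans (dist_boundary_le u Bz) _.
rewrite opprB addrC subrK enormZ gtr0_norm // /enorm dotp_delta mxE !eqxx.
by rewrite sqrtr1 mulr1.
Qed.

End HalfSpace.

Section Extremal.
Context {R : realType} {n : nat}.

(** Two points on a common normal to the boundary hyperplane, at heights [1]
and [3], so that [t = 2]; a boundary point at distance [sqrt k] from the foot of
the normal sees them under the angle with cosine
[(3 + k) / sqrt ((1 + k) * (9 + k))], which is minimal for [k = 3]. *)
Lemma halfspace_lower_sharp (i0 : 'I_n) : (2 <= n)%N ->
  let x : 'rV[R]_n := delta_mx 0 i0 in
  let y : 'rV[R]_n := 3 *: delta_mx 0 i0 in
  [/\ proper_convex_domain (halfspace (R := R) i0), halfspace i0 x, halfspace i0 y,
      x <> y &
      let t := expR (dist_ratio (halfspace i0) x y) - 1 in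
      asin (t / (t + 2)) = visual_angle (halfspace i0) x y].
Proof.
move=> hn x y.
have x0 : x 0 i0 = 1 by rewrite mxE !eqxx.
have y0 : y 0 i0 = 3 by rewrite !mxE !eqxx mulr1.
have Hx : halfspace i0 x by rewrite /halfspace /= x0.
have Hy : halfspace i0 y by rewrite /halfspace /= y0.
have HP := halfspace_proper Hx.
have B0 : boundary (halfspace (R := R) i0) !=set0.
  by exists 0; exact: halfspace_boundary0.
have xx : dotp x x = 1 by rewrite dotp_delta.
split => //.
  by move=> /rowP/(_ i0); rewrite x0 y0 => H; lra.
have tE : expR (dist_ratio (halfspace i0) x y) - 1 = 2.
  rewrite expR_dist_ratio // ?halfspace_dist // ?x0 ?y0; last exact: halfspace_open.
  have -> : x - y = (- 2) *: x.
    by rewrite /y -[X in X - _]scale1r -scalerBl; congr (_ *: _); ring.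
  rewrite enormZ /enorm xx sqrtr1 mulr1 normrN ger0_norm //.
  by rewrite min_l ?divr1 // ler1n.
apply/eqP; rewrite eq_le; apply/andP; split; first exact: visual_angle_lower.
have tE' : 2 / (2 + 2) = 1 / 2 :> R by field.
rewrite tE tE' asin_acos_sqrt; last by apply/andP; split; lra.
have -> : 1 - (1 / 2) ^+ 2 = 3 / 4 :> R by field.
have c2 : Num.sqrt (3 / 4) ^+ 2 = 3 / 4 :> R by rewrite sqr_sqrtr //; lra.
have c0 : 0 <= Num.sqrt (3 / 4) :> R := sqrtr_ge0 _.
set c := Num.sqrt _ in c0 c2 *.
apply: visual_angle_le => // z Bz.
have Hz := boundary_open_notin (halfspace_open (i0 := i0)) Bz.
have /halfspace_boundaryE z0 := Bz.
apply: angle_le_acos; [| |by lra|].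
- by apply/eqP => zx; apply: Hz; rewrite zx.
- by apply/eqP => zy; apply: Hz; rewrite zy.
have xz : dotp x z = 0 by rewrite dotpC dotp_delta.
have zz := dotp_ge0 z.
have uu : dotp (x - z) (x - z) = 1 + dotp z z.
  by rewrite !dotpE (dotpC z x) xz xx; ring.
have vv : dotp (y - z) (y - z) = 9 + dotp z z.
  by rewrite /y -/x !dotpE (dotpC z x) xz xx; ring.
have uv : dotp (x - z) (y - z) = 3 + dotp z z.
  by rewrite /y -/x !dotpE (dotpC z x) xz xx; ring.
rewrite -(ler_pXn2r (isT : (0 < 2)%N)) ?nnegrE ?mulr_ge0 ?enorm_ge0 //.
  rewrite !exprMn !enorm_sqr c2 uu vv uv.
  have := sqr_ge0 (dotp z z - 3); lra.
by rewrite uv addr_ge0.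
Qed.

(** Two points at height [1] at distance [2] from each other are seen under a
right angle from the foot of the perpendicular from their midpoint. *)
Lemma halfspace_right_angle (i0 i1 : 'I_n) : i0 != i1 ->
  exists G (x y : 'rV[R]_n), [/\ proper_convex_domain G, G x, G y,
      expR (dist_ratio G x y) - 1 = 2 & pi / 2 <= visual_angle G x y].
Proof.
move=> i01.
pose e : 'rV[R]_n := delta_mx 0 i0; pose f : 'rV[R]_n := delta_mx 0 i1.
have ee : dotp e e = 1 by rewrite dotp_delta mxE !eqxx.
have ff : dotp f f = 1 by rewrite dotp_delta mxE !eqxx.
have ef : dotp e f = 0 by rewrite dotp_delta mxE eq_sym (negbTE i01).
have x0 : (e - f) 0 i0 = 1.
  by rewrite !mxE !eqxx (negbTE i01) /= subr0.
have y0 : (e + f) 0 i0 = 1.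
  by rewrite !mxE !eqxx (negbTE i01) /= addr0.
have Hx : halfspace i0 (e - f) by rewrite /halfspace /= x0.
have Hy : halfspace i0 (e + f) by rewrite /halfspace /= y0.
exists (halfspace i0), (e - f), (e + f); split=> //.
- exact: halfspace_proper Hx.
- rewrite expR_dist_ratio // ?halfspace_dist // ?x0 ?y0.
  + have -> : e - f - (e + f) = (- 2) *: f.
      by apply/rowP => i; rewrite !mxE; ring.
    by rewrite enormZ /enorm ff sqrtr1 mulr1 normrN ger0_norm // min_l // divr1.
  + exact: halfspace_open.
  + by exists 0; exact: halfspace_boundary0.
- apply: le_trans (angle_le_visual _ _ (halfspace_boundary0 i0)).
  rewrite /angle !subr0 !dotpE (dotpC f e) ee ff ef.
  by rewrite addrA !(addr0, subr0, add0r) subrr mul0r acos0.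
Qed.

End Extremal.

Theorem theorem4p1 (R : realType) (n : nat) (hn : (2 <= n)%N) :
  [/\ (forall (G : set 'rV[R]_n) (x y : 'rV[R]_n),
        proper_convex_domain G -> G x -> G y ->
        let t := expR (dist_ratio G x y) - 1 in
        asin (t / (t + 2)) <= visual_angle G x y /\
        visual_angle G x y <= 2 * asin (t / Num.sqrt (4 + t ^+ 2))),
      (exists (G : set 'rV[R]_n) (x y : 'rV[R]_n),
        [/\ proper_convex_domain G, G x, G y, x <> y &
          let t := expR (dist_ratio G x y) - 1 in
          asin (t / (t + 2)) = visual_angle G x y]) &
      (forall c : R, c < 2 ->
        ~ (forall (G : set 'rV[R]_n) (x y : 'rV[R]_n),
            proper_convex_domain G -> G x -> G y ->
            let t := expR (dist_ratio G x y) - 1 in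
            visual_angle G x y <= c * asin (t / Num.sqrt (4 + t ^+ 2))))].
Proof.
pose i0 := Ordinal (leq_trans (isT : (0 < 2)%N) hn); pose i1 := Ordinal hn.
split=> [G x y HG Gx Gy t | | c c2 H].
- by split; [exact: visual_angle_lower | exact: visual_angle_upper].
- exists (halfspace i0), (delta_mx 0 i0), (3 *: delta_mx 0 i0).
  exact: halfspace_lower_sharp.
- have [G [x [y [HG Gx Gy tE V]]]] := @halfspace_right_angle R n i0 i1 isT.
  have := le_trans V (H G x y HG Gx Gy); rewrite tE.
  set A := asin _; apply/negP; rewrite -ltNge.
  have A2 : 2 * A = pi / 2.
    have s0 : 0 < 4 + 2 ^+ 2 :> R by lra.
    rewrite double_asin; last first.
      rewrite divr_ge0 ?sqrtr_ge0 //= ler_pdivrMr ?sqrtr_gt0 // mul1r.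
      by rewrite -[leLHS]ger0_norm // -sqrtr_sqr ler_wsqrtr //; lra.
    rewrite expr_div_n sqr_sqrtr ?(ltW s0) // -acos0; congr acos.
    by field; lra.
  have A0 : 0 < 2 * A by rewrite A2 divr_gt0 ?pi_gt0.
  rewrite pmulr_rgt0 // in A0.
  by rewrite -A2 ltr_pM2r.
Qed.
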